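(* Let $M$ be a compact metric space. Then the following conditions are equivalent: (1) the covering dimension satisfies $\dim M < \infty$; (2) there exists a total order $T$ on $M$ such that $\operatorname{Snake}(M,T) < \infty$.
   Context: A total order $T$ on a metric space $M$ is a strict total order $<_T$ on the set of points (for distinct $x,y$ exactly one of $x<_T y$, $y<_T x$ holds, and $<_T$ is transitive); no compatibility with the topology is assumed. $B_\varepsilon(x)$ denotes the open ball of radius $\varepsilon$ around $x$. For an ordered pair $(U_1,U_2)$ of subsets of $M$ and an integer $s\ge 0$, we say $(U_1,U_2)$ contains a snake of length $s$ if there are points $a_0 <_T a_1 <_T \dots <_T a_s$ such that $a_i\in U_1$ for all even $i$ and $a_i\in U_2$ for all odd $i$ ($0\le i\le s$). For distinct $x,y\in M$, $\operatorname{Snake}_T(x,y)$ is the greatest integer $s$ such that for every $\varepsilon>0$ the pair $(B_\varepsilon(x),B_\varepsilon(y))$ contains a snake of length $s$; if no greatest such number exists, $\operatorname{Snake}_T(x,y)=\infty$. The snake number of $(M,T)$ is $\operatorname{Snake}(M,T)=\sup_{x,y\in M,\,x\ne y}\operatorname{Snake}_T(x,y)\in\{0,1,2,\dots\}\cup\{\infty\}$, where the supremum is taken to be $0$ if $M$ has at most one point. Covering dimension: the order of a family $\mathcal A$ of sets is the largest integer $n$ such that $\mathcal A$ contains $n+1$ sets with non-empty intersection ($\infty$ if there is no such integer). For an integer $n\ge -1$, $\dim M\le n$ means that every finite open cover of $M$ has a finite open refinement of order $\le n$; $\dim M$ is the least such $n$, or $\infty$ if none exists; $\dim\emptyset=-1$.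 *)

(* Defs.v *)
From HB Require Import structures.
From mathcomp Require Import all_boot all_order all_algebra.
From mathcomp Require Import all_classical all_reals all_analysis.

Set Implicit Arguments.
Unset Strict Implicit.
Unset Printing Implicit Defensive.

Import Order.TTheory GRing.Theory Num.Theory.

Local Open Scope classical_set_scope.
Local Open Scope ring_scope.

(* Numbers in {-1, 0, 1, ...} together with infinity are elements of
   [\bar int]. In both definitions the set given to [xget] has at most one
   element, and [xget] returns [+oo] exactly when it is empty. *)
Definition greatest (S : set int) : \bar int :=
  xget +oo%E [set n%:E | n in S `&` ubound S].

Definition least (S : set int) : \bar int :=
  xget +oo%E [set n%:E | n in S `&` lbound S].

Definition strict_total_order (M : Type) (T : M -> M -> Prop) : Prop :=
  [/\ forall x, ~ T x x,
      forall x y, x <> y -> (T x y /\ ~ T y x) \/ (T y x /\ ~ T x y) &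
      forall x y z, T x y -> T y z -> T x z].

(* Only the values a_0, ..., a_s of the sequence [a] matter. *)
Definition contains_snake (M : Type) (T : M -> M -> Prop) (U1 U2 : set M)
    (s : nat) : Prop :=
  exists a : nat -> M,
    (forall i, (i < s)%N -> T (a i) (a i.+1)) /\
    (forall i, (i <= s)%N -> if odd i then U2 (a i) else U1 (a i)).

Definition snake_at (R : realType) (M : metricType R) (T : M -> M -> Prop)
    (x y : M) : \bar int :=
  greatest [set s%:Z | s in [set s : nat |
    forall e : R, 0 < e -> contains_snake T (ball x e) (ball y e) s]].

(* The first argument of [supremum] is its value on the empty set. *)
Definition snake_number (R : realType) (M : metricType R)
    (T : M -> M -> Prop) : \bar int :=
  supremum 0%E [set snake_at T p.1 p.2 | p in [set p : M * M | p.1 <> p.2]].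

(* The subfamily of k = n + 1 = 0 sets is always allowed, so that a family
   without non-empty members has order -1, also when [M] is empty. *)
Definition family_order (M : Type) (A : set (set M)) : \bar int :=
  greatest [set k%:Z - 1 | k in [set k : nat |
    exists2 B : set (set M), B `<=` A &
      (B #= `I_k)%card /\ (k = 0%N \/ \bigcap_(U in B) U !=set0)]].

Definition finite_open_cover (M : topologicalType) (A : set (set M)) : Prop :=
  [/\ finite_set A, A `<=` open & \bigcup_(U in A) U = [set: M]].

Definition refines (M : Type) (B A : set (set M)) : Prop :=
  forall V, B V -> exists2 U, A U & V `<=` U.

Definition covering_dim_le (M : topologicalType) (n : int) : Prop :=
  forall A : set (set M), finite_open_cover A ->
    exists B : set (set M),
      [/\ finite_open_cover B, refines B A & (family_order B <= n%:E)%E].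

Definition covering_dim (M : topologicalType) : \bar int :=
  least [set n : int | -1 <= n /\ covering_dim_le M n].

(* Main.v *)
(* Finite dimension gives an order: take finite open covers [V k] of
   multiplicity at most [p] and mesh tending to 0 such that the closure of each
   member of [V k.+1] lies in a chosen parent in [V k]. Order the points
   lexicographically along this tree. Once no member of [V k] contains both [x]
   and [y], the level [k] nodes of a snake between small balls around [x] and
   [y] strictly increase, and every other one contains [x]; so there are at most
   [p] of the latter.

   Conversely, suppose there are no snakes of length [s] between small balls. A
   one-sided limit along the order is unique, since two limits would give long
   snakes; so the order splits into finitely many intervals with small closures.
   These closures overlap only in the boundaries of finitely many cuts, and on
   the boundary of a cut the admissible snake length is smaller by one, because
   its points are also approached from the other side of the cut. Induction on
   [s] bounds the dimension of the boundaries, hence that of the space. *)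
Require Import Defs.
From mathcomp Require Import all_boot all_order all_algebra.
From mathcomp Require Import all_classical all_reals all_analysis.
From mathcomp Require Import zify.

Set Implicit Arguments.
Unset Strict Implicit.
Unset Printing Implicit Defensive.

Import Order.TTheory GRing.Theory Num.Theory.
Local Open Scope classical_set_scope.
Local Open Scope ring_scope.

(** * Compact metric spaces: Lebesgue numbers, finite nets, shrinkings *)

Lemma card_asbool_le (I : finType) (P Q : I -> Prop) :
  (forall i, P i -> Q i) ->
  (#|[pred i | `[< P i >]]| <= #|[pred i | `[< Q i >]]|)%N.
Proof.
move=> PQ; apply: subset_leq_card; apply/fintype.subsetP => i.
by rewrite !inE; exact: PQ.
Qed.

Lemma lebesgue_number (R : realType) (M : metricType R) (I : Type)
    (U : I -> set M) :
  compact [set: M] -> (forall i, open (U i)) -> (forall x, exists i, U i x) ->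
  exists2 d : R, 0 < d & forall x, exists i, ball x d `<=` U i.
Proof.
move=> /compact_near_coveringP cM oU cU.
have := cM _ 0^'+ (fun d x => exists i, ball x d `<=` U i) _.
have H : forall x : M, [set: M] x ->
    \forall x' \near x & d \near 0^'+, exists i, ball x' d `<=` U i.
  move=> x _; have [i Uix] := cU x.
  have /nbhs_ballP[e /= e0 eU] : nbhs x (U i) by exact: open_nbhs_nbhs.
  near=> x' d => /=; exists i => y x'y; apply: eU.
  have xx' : ball x (e / 2) x'.
    by near: x'; apply: nbhsx_ballx; rewrite divr_gt0.
  apply: (ball_split xx'); apply: le_ball x'y.
  by apply/ltW; near: d; apply: nbhs_right_lt; rewrite divr_gt0.
move=> /(_ _ H) {}H; near (0 : R)^'+ => d.
exists d; first exact: (near (nbhs_right_gt 0) d).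
by move=> x; have := near H d _; apply.
Unshelve. all: by end_near. Qed.

Lemma finite_net (R : realType) (M : metricType R) (d : R) :
  compact [set: M] -> 0 < d ->
  exists s : seq M, forall x, exists2 c, c \in s & (ball c d)° x.
Proof.
move=> /compact_near_coveringP cM d0.
(* Along the filter of ever larger finite lists, the near-covering form of compactness yields a
   single list. *)
pose F : set_system (seq M) :=
  filter_from [set: seq M] (fun s => [set s' | {subset s <= s'}]).
have FF : Filter F.
  apply: filter_from_filter; first by exists [::].
  move=> s t _ _; exists (s ++ t) => // u stu; split=> x xs; apply: stu;
    by rewrite mem_cat xs ?orbT.
have [x _|s _ /(_ s (fun x => id)) Hs] :=
    cM _ F (fun s x => exists2 c, c \in s & (ball c d)° x) FF.
  have [oB Bx] := open_nbhs_ball x (PosNum d0).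
  exists ((ball x d)°, [set s | x \in s]) => /=.
    split; first by apply: open_nbhs_nbhs.
    by exists [:: x] => // s xs; apply: xs; rewrite inE.
  by move=> [y s] /= [? ?]; exists x.
by exists s => x; exact: Hs.
Qed.

(** For a Lebesgue number [d], let [V i] be made of balls of radius [d / 2] about points whose
    [d]-ball lies in [U i]; limit points of [V i] stay within [d] of such a centre. *)
Lemma closed_shrinking (R : realType) (M : metricType R) (I : Type)
    (U : I -> set M) :
  compact [set: M] -> (forall i, open (U i)) -> (forall x, exists i, U i x) ->
  exists V : I -> set M, [/\ forall i, open (V i), forall x, exists i, V i x &
    forall i, closure (V i) `<=` U i].
Proof.
move=> cM oU cU; have [d d0 dU] := lebesgue_number cM oU cU.
have d20 : 0 < d / 2 by rewrite divr_gt0.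
exists (fun i => \bigcup_(y in [set y | ball y d `<=` U i]) (ball y (d / 2))°).
split=> [i|x|i x].
- by apply: bigcup_open => y _; exact: open_interior.
- by have [i xU] := dU x; exists i, x => //; exact: nbhsx_ballx.
move=> /(_ _ (nbhsx_ballx x _ d20))[y [[c cU' /interior_subset cy] xy]].
by apply: cU'; apply: (ball_split cy); exact: ball_sym.
Qed.

(** * Refinements of bounded multiplicity on a subset *)

(* The covers are covers of all of [M], although their multiplicity is bounded
   only at the points of [Z]: this makes the property stable under finite
   unions, by shrinking twice. For [Z = M] it says that [dim M < n]. *)
Definition shrinkable {R : realType} {M : metricType R} (Z : set M) (n : nat) :=
  forall (I : finType) (U : I -> set M),
    (forall i, open (U i)) -> (forall x, exists i, U i x) ->
    exists V : I -> set M,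
      [/\ forall i, open (V i), forall x, exists i, V i x,
          forall i, V i `<=` U i &
          forall z, Z z -> (#|[pred i | `[< V i z >]]| <= n)%N].

Lemma shrinkable0 (R : realType) (M : metricType R) (n : nat) :
  shrinkable (@set0 M) n.
Proof. by move=> I U oU cU; by exists U; split=> [||i x|z []]. Qed.

Lemma shrinkableU (R : realType) (M : metricType R) (Y Z : set M) (n : nat) :
  shrinkable Y n -> shrinkable Z n -> shrinkable (Y `|` Z) n.
Proof.
move=> sY sZ I U oU cU; have [V [oV cV VU Vn]] := sY I U oU cU.
have [W [oW cW WV Wn]] := sZ I V oV cV; exists W; split => //.
  by move=> i; apply: subset_trans (WV i) (VU i).
move=> z [Yz|/Wn//]; apply: leq_trans (Vn z Yz).
by apply: card_asbool_le => i; exact: WV.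
Qed.

Lemma shrink_glue (R : realType) (M : metricType R) (n : nat) (X Z : set M)
    (I : finType) (U F : I -> set M) :
  compact [set: M] -> closed X -> closed Z -> shrinkable Z n ->
  (forall i, open (U i)) -> (forall x, exists i, U i x) ->
  (forall i, closed (F i)) -> (forall i, F i `<=` U i) ->
  (forall x, X x -> exists i, F i x) ->
  (forall i j, i <> j -> F i `&` F j `<=` Z) ->
  exists V : I -> set M,
    [/\ forall i, open (V i), forall x, exists i, V i x,
        forall i, V i `<=` U i &
        forall z, X z -> (#|[pred i | `[< V i z >]]| <= n.+1)%N].
Proof.
move=> cM cX cZ sZ oU cU cF FU XF FZ.
have [V0 [oV0 cV0 V0U V0n]] := sZ I U oU cU.
have [V [oV cV VV0]] := closed_shrinking cM oV0 cV0.
(* [V] still has multiplicity at most [n] on the neighbourhood [N] of [Z]; off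
   [Z] the sets [F i] are pairwise disjoint and relatively open in [X], and they
   increase the multiplicity by one. *)
pose N := [set x | #|[pred i | `[< closure (V i) x >]]| <= n]%N.
have oN : open N.
  rewrite openE => x Nx.
  (* Only finitely many closures occur, so points near [x] lie in none that misses [x]. *)
  suff : \forall y \near x, forall i, closure (V i) y -> closure (V i) x.
    apply: filterS => y yx; apply: leq_trans Nx; exact: card_asbool_le yx.
  apply: filter_forall => i; have [Vx|nVx] := pselect (closure (V i) x).
    exact: filterE.
  have : nbhs x (~` closure (V i)).
    by apply: open_nbhs_nbhs; split => //; apply/closed_openC/closed_closure.
  exact: filterS.
have ZN : Z `<=` N.
  move=> z /V0n; apply: leq_trans; apply: card_asbool_le => i; exact: VV0.
pose G i := Z `|` \bigcup_(j in [set j | j != i]) F j.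
have cG i : closed (G i).
  by apply: closedU => //; apply: closed_bigcup => //; exact: finite_finset.
(* A point of [X] in the [i]th set lies in both [V i] and [N], or else outside [Z] and every [F j]
   with [j != i]. So a point of [F j] is in at most [n] sets besides the [j]th. *)
exists (fun i => U i `&` ~` ((X `&` ~` (V i `&` N)) `&` G i)); split.
- move=> i; apply: openI => //; apply: closed_openC; apply: closedI => //.
  by apply: closedI => //; apply: open_closedC; exact: openI.
- move=> x; have [Xx|nXx] := pselect (X x); last first.
    by have [i Uix] := cU x; exists i; split => // -[[]].
  have [Zx|nZx] := pselect (Z x).
    have [i Vix] := cV x; exists i; split.
      by apply/V0U/VV0; exact: subset_closure.
    by move=> [[_ +] _]; apply; split => //; exact: ZN.
  have [i Fix] := XF x Xx; exists i; split; first exact: FU.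
  move=> [_ [//|[j /= /eqP ji Fjx]]].
  by apply: nZx; apply: (FZ _ _ ji).
- by move=> i x [].
- move=> z Xz; have [j Fjz] := XF z Xz.
  apply: (@leq_trans #|[predU1 j & [pred i | `[< N z /\ closure (V i) z >]]]|).
    apply: subset_leq_card; apply/fintype.subsetP => i; rewrite !inE /=.
    move=> [Uiz nG]; case: (eqVneq i j) => //= ij; apply/asboolP.
    apply: contrapT => nVz; apply: nG; split.
      by split => // -[/subset_closure Vz Nz]; apply: nVz.
    by right; exists j => //=; rewrite eq_sym.
  rewrite cardU1 -add1n; apply: leq_add; first exact: leq_b1.
  have [Nz|nNz] := pselect (N z).
    by apply: leq_trans Nz; apply: card_asbool_le => i [].
  by rewrite eq_card0// => i; apply/negbTE; rewrite !inE; apply/asboolP => -[].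
Qed.

(** * Decomposition into pieces subordinate to a cover *)

(* The set [F i] gathers the pieces of [closure A] assigned to the member [U i]
   of the cover; distinct pieces overlap only in the exceptional set [Z]. *)
Definition cells {R : realType} {M : metricType R} (X : set M) (n : nat)
    (I : finType) (U : I -> set M) (A : set M) :=
  exists (F : I -> set M) (Z : set M),
    [/\ closed Z /\ shrinkable Z n,
        forall i, closed (F i),
        forall i, F i `<=` U i `&` (X `&` closure A),
        forall x, X x -> closure A x -> exists i, F i x &
        forall i j, i <> j -> F i `&` F j `<=` Z].

Lemma cells0 (R : realType) (M : metricType R) (X : set M) (n : nat)
    (I : finType) (U : I -> set M) : cells X n U set0.
Proof.
exists (fun=> set0), set0; split=> [|i|i x []|x _|i j _ x []//].
- by split; [exact: closed0|exact: shrinkable0].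
- exact: closed0.
- by rewrite closure0.
Qed.

Lemma cells_sub (R : realType) (M : metricType R) (X : set M) (n : nat)
    (I : finType) (U : I -> set M) (A B : set M) :
  A `<=` B -> cells X n U B -> cells X n U A.
Proof.
move=> AB [F [Z [cZ cF FU XF FZ]]].
exists (fun i => F i `&` closure A), Z; split=> //.
- by move=> i; apply: closedI => //; exact: closed_closure.
- by move=> i x [/FU[Ux [Xx _]] Ax].
- by move=> x Xx Ax; have [i Fx] := XF x Xx (closureS AB Ax); exists i.
- by move=> i j ij x [[Fi _] [Fj _]]; apply: (FZ i j ij).
Qed.

(** The part of [X] in the closure of [B] minus [A] is assigned to [i0]. It meets the old pieces
    only on the boundary of the cut at [A], which joins the exceptional set. *)
Lemma cells_extend (R : realType) (M : metricType R) (X : set M) (n : nat)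
    (I : finType) (U : I -> set M) (E A B : set M) (i0 : I) :
  closed X -> A `<=` B -> B `<=` E ->
  shrinkable (X `&` closure A `&` closure (E `\` A)) n ->
  X `&` closure (B `\` A) `<=` U i0 ->
  cells X n U A -> cells X n U B.
Proof.
move=> cX AB BE sA BU [F [Z [[cZ sZ] cF FU XF FZ]]].
have cD : closed (X `&` closure (B `\` A)).
  by apply: closedI => //; exact: closed_closure.
have BA : closure (B `\` A) `<=` closure (E `\` A).
  by apply: closureS => x [/BE].
pose C := X `&` closure A `&` closure (E `\` A).
have FC i x : F i x -> closure (B `\` A) x -> C x.
  by move=> /FU[_ [Xx Ax]] /BA ?.
exists (fun i => F i `|` [set x | i = i0 /\ (X `&` closure (B `\` A)) x]).
exists (Z `|` C); split.
- split; last exact: shrinkableU.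
  apply: closedU => //; apply: closedI; last exact: closed_closure.
  by apply: closedI => //; exact: closed_closure.
- move=> i; apply: closedU => //; have [->|ii0] := eqVneq i i0.
    by rewrite (_ : [set x | _] = X `&` closure (B `\` A))//;
      apply/seteqP; split=> [x []//|x].
  rewrite (_ : [set x | _] = set0); first exact: closed0.
  by apply/seteqP; split=> // x [/eqP]; rewrite (negbTE ii0).
- move=> i y [/FU[Ux [Xx /(closureS AB)]]//|[-> BAx]]; split; first exact: BU.
  by case: BAx => Xx BAx; split => //; apply: closureS BAx => z [].
- move=> x Xx Bx.
  have [Ax|BAx] : (closure A `|` closure (B `\` A)) x.
  - by rewrite -closureU setDUK.
    by have [i Fx] := XF x Xx Ax; exists i; left.
  by exists i0; right.
- move=> i j ij x [[Fi|[ei [Xx BAx]]] [Fj|[ej [Xx' BAx']]]].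
  + by left; apply: (FZ i j ij).
  + by right; apply: FC Fi _.
  + by right; apply: FC Fj _.
  + by case: ij; rewrite ei ej.
Qed.

(** * One-sided limits and cuts in the absence of long snakes *)

Lemma directed_cluster (T : topologicalType) (I : Type) (D : set I)
    (S : I -> set T) :
  compact [set: T] -> D !=set0 ->
  (forall i, D i -> closed (S i)) -> (forall i, D i -> S i !=set0) ->
  (forall i j, D i -> D j -> exists2 k, D k & S k `<=` S i `&` S j) ->
  exists x, forall i, D i -> S i x.
Proof.
move=> cT [i0 Di0] cS S0 dS; pose F := filter_from D S.
have FF : ProperFilter F.
  apply: filter_from_proper => //.
  apply: filter_from_filter; first by exists i0.
  by move=> i j Di Dj; have [k Dk Sk] := dS i j Di Dj; exists k.
have [x [_ Fx]] := cT F FF (filterT).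
exists x => i Di; apply: (cS i Di) => B Bx; apply: Fx => //.
by exists i.
Qed.

Lemma contains_snakeS (M : Type) (T : M -> M -> Prop) (U1 U2 V1 V2 : set M)
    (s : nat) :
  U1 `<=` V1 -> U2 `<=` V2 ->
  contains_snake T U1 U2 s -> contains_snake T V1 V2 s.
Proof.
move=> UV1 UV2 [a [aT aU]]; exists a; split=> // i /aU.
by case: ifP => _; [exact: UV2|exact: UV1].
Qed.

(** Reversal preserves the parity of indices when the length is even, and exchanges the two sets
    when it is odd. *)
Lemma contains_snake_flip (M : Type) (T : M -> M -> Prop) (U1 U2 : set M)
    (s : nat) :
  contains_snake (fun x y => T y x) U1 U2 s ->
  contains_snake T U1 U2 s \/ contains_snake T U2 U1 s.
Proof.
move=> [a [aT aU]].
have H : forall i, (i < s)%N -> T (a (s - i)%N) (a (s - i.+1)%N).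
  move=> i si; have := aT (s - i.+1)%N; rewrite subnSK//; apply.
  exact: leq_subr.
case: (boolP (odd s)) => os; [right|left]; exists (fun i => a (s - i)%N);
  split=> // i si; have := aU (s - i)%N (leq_subr _ _);
  rewrite oddB// ?(negbTE os) ?os; by case: (odd i).
Qed.

(* If the closures of the final segments of [A] had two common points in [X],
   one could climb in [A] alternating between them, building long snakes. *)
Lemma tail_small (R : realType) (M : metricType R) (T : M -> M -> Prop)
    (E X A : set M) (I : Type) (U : I -> set M) (s : nat) :
  compact [set: M] -> strict_total_order T -> closed X -> A `<=` E ->
  A !=set0 -> (forall i, open (U i)) -> (forall x, exists i, U i x) ->
  (forall x y, X x -> X y -> x <> y -> exists2 e : R, 0 < e &
    ~ contains_snake T (E `&` ball x e) (E `&` ball y e) s) ->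
  exists a i, A a /\ X `&` closure (A `&` T a) `<=` U i.
Proof.
move=> cM [Tirr Ttot Ttr] cX AE A0 oU cU noS; apply: contrapT => nex.
pose S a := X `&` closure (A `&` T a).
have nS a i : A a -> ~ S a `<=` U i.
  by move=> Aa SU; apply: nex; exists a, i.
have cS a : closed (S a) by apply: closedI => //; exact: closed_closure.
have Sle a b : T a b -> S b `<=` S a.
  move=> ab x [Xx Bx]; split => //; apply: closureS Bx => y [Ay].
  by split => //; apply: Ttr ab _.
have dS (B : set M) a b : A a -> A b ->
    exists2 c, A c & S c `&` B `<=` (S a `&` B) `&` (S b `&` B).
  move=> Aa Ab; have [->|ab] := pselect (a = b); first by exists b => // x.
  case: (Ttot a b ab) => -[abT _].
    by exists b => // x [Sx Bx]; split; split => //; exact: (Sle _ _ abT).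
  by exists a => // x [Sx Bx]; split; split => //; exact: (Sle _ _ abT).
have [a0 Aa0] := A0.
have key (B : set M) : closed B -> (forall a, A a -> S a `&` B !=set0) ->
    exists x, forall a, A a -> S a x /\ B x.
  move=> cB SB; apply: (directed_cluster (S := fun a => S a `&` B)) => //.
    by move=> a _; exact: closedI.
  by move=> a b; exact: dS.
(* No [S a] fits into a member of the cover. This gives first a point [x] common to all [S a], then,
   for [U i] around [x], a common point [y] outside [U i]. *)
have [a Aa|x Sx] := key setT closedT.
  have [i _] := cU a0; apply: contrapT => S0; apply: (nS a i Aa).
  by move=> x Sx; case: S0; exists x.
have [i Ux] := cU x.
have [|a Aa|y Sy] := key (~` U i); first exact: open_closedC.
  apply: contrapT => S0; apply: (nS a i Aa) => y Sy.
  by apply: contrapT => nUy; case: S0; exists y.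
have [[Xx _] _] := Sx a0 Aa0; have [[Xy _] nUy] := Sy a0 Aa0.
have [|e e0] := noS x y Xx Xy; first by move=> xy; apply: nUy; rewrite -xy.
apply; have nxt (z : M) : (forall a, A a -> S a z) -> forall a, A a ->
    exists b, A b /\ T a b /\ ball z e b.
  move=> Sz a Aa; have [_ /(_ _ (nbhsx_ballx z _ e0))] := Sz a Aa.
  by move=> [b [[Ab ab] zb]]; exists b.
have nxt' (n : nat) (a : {a | A a}) : {b : {a | A a} |
    T (sval a) (sval b) /\ ball (if odd n then y else x) e (sval b)}.
  case: a => a Aa; apply: cid => /=.
  have [|b [Ab [ab zb]]] := nxt (if odd n then y else x) _ a Aa.
    by case: ifP => _ b Ab; [case: (Sy b Ab)|case: (Sx b Ab)].
  by exists (exist _ b Ab).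
pose fix f (n : nat) : {a | A a} :=
  if n is m.+1 then sval (nxt' m (f m)) else exist _ a0 Aa0.
(* The index is shifted because [a0] only starts the climb and need not be near [x] or [y]. *)
exists (fun n => sval (f n.+1)); split=> [j _|j _].
  by rewrite [f j.+2]/=; case: (nxt' j.+1 (f j.+1)) => b [].
have := svalP (f j.+1); rewrite [f j.+1]/=; case: (nxt' j (f j)) => b [_ /=].
by case: ifP => _ zb /AE.
Qed.

Definition initial_in (M : Type) (T : M -> M -> Prop) (E A : set M) :=
  A `<=` E /\ forall x y, E x -> A y -> T x y -> A x.

Lemma cells_full (R : realType) (M : metricType R) (T : M -> M -> Prop)
    (E X : set M) (n s : nat) (I : finType) (U : I -> set M) :
  compact [set: M] -> strict_total_order T -> closed X ->
  (forall i, open (U i)) -> (forall x, exists i, U i x) ->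
  (forall x y, X x -> X y -> x <> y -> exists2 e : R, 0 < e &
    ~ contains_snake T (E `&` ball x e) (E `&` ball y e) s) ->
  (forall A, initial_in T E A ->
    shrinkable (X `&` closure A `&` closure (E `\` A)) n) ->
  cells X n U E.
Proof.
move=> cM sT cX oU cU noS sh; have [Tirr Ttot Ttr] := sT.
(* Because one-sided limits are unique, [A] has the required cells itself, and
   it can be enlarged as long as it differs from [E]. *)
pose A := \bigcup_(B in [set B | initial_in T E B /\ cells X n U B]) B.
have AE : A `<=` E by move=> x [B [[BE _] _]] /BE.
have lA : initial_in T E A.
  split=> // x y Ex [B [BE Bn] By] xy; exists B; first by split.
  by case: BE => _; apply; [|exact: By|].
(* The tail of [A] beyond some [a] fits one [U i], and the part up to [a] lies in a single segment
   [B] of the union. *)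
have cA : cells X n U A.
  have [A0|/set0P A0] := eqVneq A set0; first by rewrite A0; exact: cells0.
  have [a [i [Aa aU]]] := tail_small cM sT cX AE A0 oU cU noS.
  pose A' := A `&` [set x | x = a \/ T x a].
  have A'A : A' `<=` A by move=> x [].
  have lA' : initial_in T E A'.
    split=> [x [/AE]//|x y Ex [Ay ya] xy]; split.
      by case: lA => _; apply; [|exact: Ay|].
    by right; case: ya => [<-//|ya]; apply: Ttr ya.
  have cA' : cells X n U A'.
    case: Aa => B [lB cB] Ba; apply: cells_sub cB => x [Ax [->//|xa]].
    by case: lB => _; apply; [exact: AE|exact: Ba|].
  apply: (cells_extend (i0 := i) cX A'A AE (sh _ lA') _ cA').
  apply: subset_trans aU => x [Xx cx]; split => //; apply: closureS cx.
  move=> y [Ay nA'y]; split => //.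
  case: (Ttot a y) => [ay|[]//|[ya _]]; first by apply: nA'y; split => //; left.
  by case: nA'y; split => //; right.
have [EA|nEA] := pselect (E `<=` A); first exact: cells_sub EA cA.
have [b0 Db0] : (E `\` A) !=set0.
  apply: contrapT => D0; apply: nEA => x Ex; apply: contrapT => nAx.
  by apply: D0; exists x.
(* In the reversed order, the tail argument applies to the points just above the cut at [A]. *)
have sT' : strict_total_order (fun x y => T y x).
  split=> // [x y xy|x y z]; first by case: (Ttot x y xy); [right|left].
  by move=> yx zy; apply: Ttr zy yx.
have noS' x y : X x -> X y -> x <> y -> exists2 e : R, 0 < e &
    ~ contains_snake (fun x y => T y x) (E `&` ball x e) (E `&` ball y e) s.
  move=> Xx Xy xy; have [e e0 He] := noS x y Xx Xy xy.
  have [d d0 Hd] := noS y x Xy Xx (nesym xy).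
  (* Reversing a snake may exchange [x] and [y], so both radii are needed. *)
  exists (Num.min e d); first by rewrite lt_min e0.
  have le (z : M) : E `&` ball z (Num.min e d) `<=` E `&` ball z e /\
      E `&` ball z (Num.min e d) `<=` E `&` ball z d.
    by split; apply: setIS; apply: le_ball; rewrite ge_min lexx ?orbT.
  move=> /contains_snake_flip[/contains_snakeS|/contains_snakeS].
    by move=> /(_ _ _ (le x).1 (le y).1).
  by move=> /(_ _ _ (le y).2 (le x).2).
have DE : E `\` A `<=` E by move=> x [].
have D0 : (E `\` A) !=set0 by exists b0.
have [b [i [[Eb nAb] bU]]] := tail_small cM sT' cX DE D0 oU cU noS'.
(* The tail bound controls only points strictly below [b]. Adding [b] itself, as a separate piece,
   makes [A2] strictly larger than [A], a contradiction. *)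
pose A1 := A `|` ((E `\` A) `&` [set x | T x b]).
pose A2 := A1 `|` [set b].
have A1E : A1 `<=` E by move=> x [/AE//|[[]]].
have A2E : A2 `<=` E by move=> x [/A1E//|->].
have lA1 : initial_in T E A1.
  split=> // x y Ex A1y xy; have [Ax|nAx] := pselect (A x); first by left.
  right; split => //=; case: A1y => [Ay|[_ yb]]; last exact: Ttr xy yb.
  by case: nAx; case: lA => _; apply; [|exact: Ay|].
have cA1 : cells X n U A1.
  apply: (cells_extend (i0 := i) cX _ A1E (sh _ lA) _ cA).
    by move=> x; left.
  apply: subset_trans bU => x [Xx cx]; split => //; apply: closureS cx.
  by move=> y [[|]].
have cA2 : cells X n U A2.
  have [j Ujb] := cU b.
  apply: (cells_extend (i0 := j) cX _ A2E (sh _ lA1) _ cA1).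
    by move=> x; left.
  move=> x [_ cx]; suff -> : x = b by [].
  have /accessible_closed_set1/(_ b) : accessible_space M.
    by apply: hausdorff_accessible; exact: metric_hausdorff.
  by apply; apply: closureS cx => y [[]].
case: nAb; exists A2; last by right.
split=> //; split=> // x y Ex A2y xy; have [Ax|nAx] := pselect (A x).
  by left; left.
left; case: A2y xy => [A1y xy|-> xb]; last by right.
by case: lA1 => _; apply; [|exact: A1y|].
Qed.

(* A point of [closure A] and [closure (E `\` A)], for an initial segment [A] of
   [E], is approached from both sides of the cut. Hence a snake in [A] between
   two such points extends by a point of [E `\` A], and the snake length drops
   by one on the boundary of each cut. *)
Lemma snakeless_shrinkable (R : realType) (M : metricType R)
    (T : M -> M -> Prop) (s : nat) (E X : set M) :
  compact [set: M] -> strict_total_order T -> closed X -> X `<=` closure E ->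
  (forall x y, X x -> X y -> x <> y -> exists2 e : R, 0 < e &
    ~ contains_snake T (E `&` ball x e) (E `&` ball y e) s) ->
  shrinkable X s.+1.
Proof.
move=> cM sT; elim: s E X => [|s IHs] E X cX XE noS I U oU cU.
  (* A snake of length 0 is a single point of [E] near the first centre, so here [X] has at most one
     point; it is removed from all members of the cover but one. *)
  have [[x Xx]|X0] := pselect (X !=set0); last first.
    exists U; split=> [||i x|z Xz]//; by case: X0; exists z.
  have X1 y : X y -> y = x.
    move=> Xy; apply: contrapT => yx; have [e e0] := noS y x Xy Xx yx.
    apply; have [a [Ea ya]] := XE y Xy _ (nbhsx_ballx y _ e0).
    by exists (fun=> a); split=> // i; rewrite leqn0 => /eqP ->.
  have [i0 Ux] := cU x.
  exists (fun i => if i == i0 then U i else U i `&` ~` X); split.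
  - move=> i; case: ifP => // _; apply: openI => //; exact: closed_openC.
  - move=> y; have [/X1->|nXy] := pselect (X y).
      by exists i0; rewrite eqxx.
    by have [i Uy] := cU y; exists i; case: ifP.
  - by move=> i y; case: ifP => // _ [].
  - move=> z Xz; rewrite -(card1 i0); apply: subset_leq_card.
    apply/fintype.subsetP => i; rewrite !inE.
    by case: (i == i0) => // -[].
have [|F [Z [[cZ sZ] cF FU XF FZ]]] :=
    cells_full (n := s.+1) cM sT cX oU cU noS.
  move=> A [AE lA]; apply: (IHs A).
  - by apply: closedI; [apply: closedI => //|]; exact: closed_closure.
  - by move=> x [[]].
  move=> x y [[Xx cx] dx] [[Xy cy] dy] xy; have [e e0 nS] := noS x y Xx Xy xy.
  exists e => // -[a [aT aU]]; apply: nS.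
  have [c [[Ec nAc] zc]] : ((E `\` A) `&`
      (if odd s.+1 then ball y e else ball x e)) !=set0.
    by case: ifP => _; [apply: dy|apply: dx]; exact: nbhsx_ballx.
  exists (fun i => if (i <= s)%N then a i else c); split=> i iS.
    have [si|si] := ltnP i s; first by rewrite (ltnW si); exact: aT.
    have -> : i = s by lia.
    rewrite leqnn; case: (sT) => _ Ttot _.
    have As : A (a s) by have := aU s (leqnn s); case: ifP => _ [].
    case: (Ttot (a s) c) => [ac|[]//|[ca _]]; first by apply: nAc; rewrite -ac.
    by case: nAc; apply: lA ca.
  case: (leqP i s) => is_; first by have := aU i is_; case: ifP => _ [/AE].
  have -> : i = s.+1 by lia.
  by move: zc; case: ifP.
have {}FU' i : F i `<=` U i by move=> x /FU[].
apply: (shrink_glue cM cX cZ sZ oU cU cF FU' _ FZ).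
by move=> x Xx; apply: XF => //; exact: XE.
Qed.

(** * Numerical invariants expressed by explicit bounds *)

(** A nonempty set of integers bounded above has a maximum, which rules out the default [+oo]; on
    the empty set that default is the value. *)
Lemma greatest_leP (S : set int) (n : int) :
  S !=set0 -> ((greatest S <= n%:E)%E <-> ubound S n).
Proof.
move=> [s Ss]; rewrite /greatest; split.
  case: xgetP => [_ _ [m [Sm mS] <-]|_]; last by rewrite leNgt ltry.
  by rewrite lee_fin => mn t /mS tm; exact: le_trans tm mn.
move=> Sn; case: xgetP => [_ _ [m [Sm mS] <-]|nmax].
  by rewrite lee_fin; exact: Sn.
have ex : exists k : nat, `[< S (n - k%:Z) >].
  exists `|n - s|%N; apply/asboolP; rewrite gez0_abs ?subKr// subr_ge0.
  exact: Sn.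
case: (ex_minnP ex) => k /asboolP Sk mink.
case: (nmax (n - k%:Z)%:E); exists (n - k%:Z) => //; split=> // t St.
have tn := Sn t St; have := mink `|n - t|%N.
rewrite gez0_abs ?subr_ge0// subKr => /(_ (asboolT St)); lia.
Qed.

Lemma family_order_leP (M : Type) (A : set (set M)) (n : nat) :
  (family_order A <= (n%:Z - 1)%:E)%E <->
  forall k (b : nat -> set M) z, {in `I_k &, injective b} ->
    (forall j, (j < k)%N -> A (b j) /\ b j z) -> (k <= n)%N.
Proof.
rewrite /family_order greatest_leP; last first.
  exists (0%:Z - 1), 0%N => //; exists set0 => //.
  by rewrite II0; split; [exact: card_eq00|left].
split=> [An k b z binj bA|H _ [k [B BA [Bk BI]] <-]].
  suff : k%:Z - 1 <= n%:Z - 1 by lia.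
  apply: An; exists k => //; exists (b @` `I_k).
    by move=> _ [j /= jk <-]; case: (bA j jk).
  split; first exact: inj_card_eq.
  have [->|k0] := posnP k; [by left|right; exists z].
  by move=> _ [j /= jk <-]; case: (bA j jk).
suff : (k <= n)%N by lia.
case: BI => [->//|[z Bz]].
move: Bk; rewrite card_eq_sym => /card_set_bijP[b [bB binj _]].
apply: (H k b z) => // j jk; split; first by apply/BA/bB.
by apply: Bz; exact: bB.
Qed.

Lemma shrinkable_dim (R : realType) (M : metricType R) (n : nat) :
  shrinkable [set: M] n -> covering_dim_le M (n%:Z - 1).
Proof.
move=> sM A [fA oA cA].
have /finite_setP[m] := fA; rewrite card_eq_sym => /card_set_bijP[u [uA _ Au]].
have [||V [oV cV VU Vn]] := sM 'I_m (fun i => u i).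
- by move=> i; apply: oA; apply: uA => /=.
- move=> x; have : [set: M] x by [].
  by rewrite -cA => -[_ /Au[i /= im <-] uix]; exists (Ordinal im).
exists (range V); split.
- split.
  + exact: finite_image finite_finset.
  + by move=> _ [i _ <-]; exact: oV.
  + apply/seteqP; split=> // x _; have [i Vx] := cV x.
    by exists (V i) => //; exists i.
- by move=> _ [i _ <-]; exists (u i); [apply: uA => /=|exact: VU].
apply/family_order_leP => k b z binj bV.
(* Several indices may give the same set, but distinct sets have distinct indices, so counting
   indices bounds the order. *)
have H (j : 'I_k) : {i : 'I_m | V i = b j}.
  by apply: cid; have [[i _ Vi] _] := bV j (ltn_ord j); exists i.
pose f j := sval (H j).
have finj : injective f.
  move=> j j' fj; apply/val_inj/binj; rewrite ?inE//=.
  by rewrite -(svalP (H j)) -(svalP (H j')); congr V.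
rewrite -(card_ord k) -(card_codom finj); apply: leq_trans (Vn z Logic.I).
apply: subset_leq_card; apply/fintype.subsetP => _ /codomP[j ->].
by rewrite !inE /f (svalP (H j)); case: (bV j (ltn_ord j)).
Qed.

Lemma contains_snake_le (M : Type) (T : M -> M -> Prop) (U1 U2 : set M)
    (s t : nat) :
  (s <= t)%N -> contains_snake T U1 U2 t -> contains_snake T U1 U2 s.
Proof.
move=> st [a [aT aU]]; exists a; split=> i iS; first exact/aT/leq_trans/st.
exact/aU/leq_trans/st.
Qed.

Lemma snake_at_leP (R : realType) (M : metricType R) (T : M -> M -> Prop)
    (x y : M) (s : nat) :
  (snake_at T x y <= s%:Z%:E)%E <->
  exists2 e : R, 0 < e & ~ contains_snake T (ball x e) (ball y e) s.+1.
Proof.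
rewrite /snake_at greatest_leP; last first.
  exists 0%:Z, 0%N => // e e0; exists (fun=> x); split=> // i.
  by rewrite leqn0 => /eqP ->; exact: ballxx.
split=> [us|[e e0 nS] _ [t tS <-]].
  apply: contrapT => nex.
  suff : s.+1%:Z <= s%:Z by lia.
  apply: us; exists s.+1 => // e e0; apply: contrapT => nS.
  by apply: nex; exists e.
suff : (t <= s)%N by lia.
rewrite leqNgt; apply/negP => st; apply: nS.
exact: contains_snake_le st (tS e e0).
Qed.

Lemma snake_number_lty (R : realType) (M : metricType R) (T : M -> M -> Prop) :
  (snake_number T < +oo)%E <->
  exists s : nat, forall x y : M, x <> y ->
    exists2 e : R, 0 < e & ~ contains_snake T (ball x e) (ball y e) s.
Proof.
rewrite /snake_number; set A := (X in supremum _ X); split.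
  move=> Aoo; apply: contrapT => nb.
  have nA (s : nat) : exists2 a, A a & ~~ (a <= s%:Z%:E)%E.
    apply: contrapT => nex; apply: nb; exists s.+1 => x y xy.
    apply/snake_at_leP; apply: contrapT => nS; apply: nex.
    by exists (snake_at T x y); [exists (x, y)|exact/negP].
  have ooA : supremums A +oo%E.
    split=> [a _|b Ab]; first exact: leey.
    case: b Ab => [b|//|] Ab.
      have [a /Ab ab /negP] := nA `|b|%N; case; apply: le_trans ab _.
      by rewrite lee_fin; lia.
    have [a /Ab ab /negP] := nA 0%N; case; apply: le_trans ab _.
    exact: leNye.
  move: Aoo; rewrite /supremum; case: ifP => [/eqP A0|_].
    by have [a] := nA 0%N; rewrite A0.
  rewrite (xget_subset1 _ ooA); first by rewrite ltxx.
  exact: is_subset1_supremums.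
move=> [s Hs]; have us : ubound A s%:Z%:E.
  move=> _ [[x y] /= xy <-]; apply/snake_at_leP; have [e e0 nS] := Hs x y xy.
  by exists e => // /(contains_snake_le (leqnSn s)).
rewrite /supremum; case: ifP => _; first exact: ltry.
case: xgetP => [a _ [_ /(_ _ us) las]|_]; last exact: ltry.
exact: le_lt_trans las (ltry _).
Qed.

Lemma covering_dim_lty (M : topologicalType) :
  (covering_dim M < +oo)%E <-> exists n : nat, covering_dim_le M (n%:Z - 1).
Proof.
rewrite /covering_dim /least; set S := (X in X `&` _); split.
  case: xgetP => [_ _ [m [[m1 Mm] _] <-] _|]; last by rewrite ltxx.
  by exists (absz (m + 1)); rewrite gez0_abs ?addrK//; lia.
move=> [n Mn].
have ex : exists k : nat, `[< S (k%:Z - 1) >].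
  by exists n; apply/asboolP; split => //; lia.
case: (ex_minnP ex) => k /asboolP Sk mink.
case: xgetP => [_ _ [m _ <-]|nmin]; first exact: ltry.
case: (nmin (k%:Z - 1)%:E); exists (k%:Z - 1) => //; split=> // t St.
have [t1 _] := St; have := mink (absz (t + 1)).
rewrite gez0_abs ?addrK; last by lia.
by move=> /(_ (asboolT St)); lia.
Qed.

(** * Construction of an order from finite dimension *)

Lemma strict_total_orderI (M : Type) (T : M -> M -> Prop) :
  (forall x, ~ T x x) -> (forall x y, x <> y -> T x y \/ T y x) ->
  (forall x y z, T x y -> T y z -> T x z) -> strict_total_order T.
Proof.
move=> Tirr Ttot Ttr; split=> // x y /Ttot[xy|yx]; [left|right]; split=> //.
  by move=> /(Ttr _ _ _ xy)/Tirr.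
by move=> /(Ttr _ _ _ yx)/Tirr.
Qed.

Lemma strict_total_order_exists (X : choiceType) :
  exists T : X -> X -> Prop, strict_total_order T.
Proof.
have [r wr] := wochoice.well_ordering_principle X.
have rtot x y : r x y || r y x.
  exact: (wochoice.wo_chainW (C := predT) (fun A _ => wr A)).
have ras x y : r x y -> r y x -> x = y.
  move=> xy yx; apply: (wochoice.wo_chain_antisymmetric (C := predT)
    (fun A _ => wr A)) => //; exact/andP.
exists (fun x y => r x y /\ x <> y); apply: strict_total_orderI.
- by move=> x [].
- by move=> x y xy; case/orP: (rtot x y) => ?; [left|right]; split=> // /esym.
move=> x y z [xy nxy] [yz nyz].
(* Transitivity is read off from the least of the three points. *)
have [|t [[tA tmin] _]] := wr (mem [:: x; y; z]).
  by exists x; rewrite !inE eqxx.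
have tx : r t x by apply: tmin; rewrite !inE eqxx.
have ty : r t y by apply: tmin; rewrite !inE eqxx orbT.
have tz : r t z by apply: tmin; rewrite !inE eqxx !orbT.
move: tA; rewrite !inE => /or3P[] /eqP et; subst t.
- by split=> // exz; apply: nxy; apply: ras => //; rewrite exz.
- by case: nxy; apply: ras.
- by case: nyz; apply: ras.
Qed.

Lemma fine_refinement (R : realType) (M : metricType R) (p : nat)
    (V : set (set M)) (e : R) :
  compact [set: M] -> covering_dim_le M (p%:Z - 1) -> finite_open_cover V ->
  0 < e ->
  exists W : set (set M), [/\ finite_open_cover W,
    forall U, W U -> exists2 U', V U' & closure U `<=` U',
    forall U x y, W U -> U x -> U y -> ball x e y &
    (family_order W <= (p%:Z - 1)%:E)%E].
Proof.
move=> cM dM [_ oV cV] e0.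
have [||d d0 dV] := lebesgue_number (U := fun U : {U | V U} => sval U) cM.
- by move=> [U VU]; exact: oV.
- move=> x; have : [set: M] x by [].
  by rewrite -cV => -[U VU Ux]; exists (exist _ U VU).
(* With balls of radius [r / 2], the closure of a member stays in one ball of radius [d], and any
   two points of a member are within [e]. *)
pose r := Num.min d e; have r0 : 0 < r by rewrite lt_min d0.
have r20 : 0 < r / 2 by rewrite divr_gt0.
have [s sM] := finite_net cM r20.
have [|W [cW WA oW]] := dM [set (ball c (r / 2))° | c in [set` s]].
  split.
  - exact/finite_image/finite_seq.
  - by move=> _ [c _ <-]; exact: open_interior.
  - apply/seteqP; split=> // x _; have [c cs cx] := sM x.
    by exists (ball c (r / 2))° => //; exists c.
exists W; split=> // [U /WA[_ [c _ <-] Uc]|U x y /WA[_ [c _ <-] Uc] Ux Uy].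
  have [[U' VU'] /= cU'] := dV c; exists U' => // z.
  move=> /(_ _ (nbhsx_ballx z _ r20))[y [/Uc/interior_subset cy /ball_sym yz]].
  apply: cU'; apply: (@le_ball _ _ _ r); first by rewrite ge_min lexx.
  exact: ball_split cy yz.
apply: (@le_ball _ _ _ r); first by rewrite ge_min lexx orbT.
move/Uc/interior_subset/ball_sym: Ux => xc.
by move/Uc/interior_subset: Uy => cy; exact: ball_split xc cy.
Qed.

Lemma cover_tower (R : realType) (M : metricType R) (p : nat) :
  compact [set: M] -> covering_dim_le M (p%:Z - 1) ->
  exists (V : nat -> set (set M)) (par : nat -> set M -> set M), forall k,
    [/\ finite_open_cover (V k),
        forall U, V k.+1 U -> V k (par k U) /\ closure U `<=` par k U,
        forall U x y, V k.+1 U -> U x -> U y -> ball x k.+1%:R^-1 y &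
        (family_order (V k.+1) <= (p%:Z - 1)%:E)%E].
Proof.
move=> cM dM.
have step (k : nat) (V : {V : set (set M) | finite_open_cover V}) :
    {W : {V : set (set M) | finite_open_cover V} | [/\
    forall U, sval W U -> exists2 U', sval V U' & closure U `<=` U',
    forall U x y, sval W U -> U x -> U y -> ball x k.+1%:R^-1 y &
    (family_order (sval W) <= (p%:Z - 1)%:E)%E]}.
  apply: cid; case: V => V cV /=.
  have k0 : 0 < k.+1%:R^-1 :> R by rewrite invr_gt0.
  have [W [cW WV Wk Wp]] := fine_refinement cM dM cV k0.
  by exists (exist _ W cW).
(* The root level is the trivial cover, so mesh and order are controlled only from level 1 on. *)
have c0 : finite_open_cover [set [set: M]].
  split; first exact: finite_set1.
    by move=> _ ->; exact: openT.
  by rewrite bigcup_set1.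
pose fix C n := if n is k.+1 then sval (step k (C k)) else exist _ _ c0.
pose V k := sval (C k).
have par_ex (q : nat * set M) : exists U', V q.1.+1 q.2 ->
    V q.1 U' /\ closure q.2 `<=` U'.
  have [Vq|nVq] := pselect (V q.1.+1 q.2); last by exists set0.
  have [H _ _] := svalP (step q.1 (C q.1)).
  by have [U' VU' UU'] := H _ Vq; exists U'.
have [par parP] := choice par_ex.
exists V, (fun k U => par (k, U)) => k.
have [_ H1 H2] := svalP (step k (C k)).
split=> //; first exact: svalP (C k).
by move=> U; exact: (parP (k, U)).
Qed.

(* The lexicographic order on the tree given by the parent maps, restricted to
   level [k]: nodes are compared by their parents first. *)
Fixpoint lex (X : Type) (par : nat -> X -> X) (lt : X -> X -> Prop) (k : nat)
    (u v : X) : Prop :=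
  if k is j.+1 then
    lex par lt j (par j u) (par j v) \/ par j u = par j v /\ lt u v
  else lt u v.

(* For [u] on level [k + d], the ancestor of [u] on level [k]. *)
Fixpoint ancestor (X : Type) (par : nat -> X -> X) (k d : nat) (u : X) : X :=
  if d is j.+1 then ancestor par k j (par (k + j)%N u) else u.

Lemma lex_total_order (X : Type) (par : nat -> X -> X) (lt : X -> X -> Prop)
    (k : nat) :
  strict_total_order lt -> strict_total_order (lex par lt k).
Proof.
move=> lto; case: (lto) => irr tot tr.
elim: k => // k [irrk totk trk]; apply: strict_total_orderI => /=.
- by move=> x [/irrk|[_ /irr]].
- move=> x y xy; have [exy|nxy] := pselect (par k x = par k y).
    by case: (tot x y xy) => -[? _]; [left|right]; right.
  by case: (totk _ _ nxy) => -[? _]; [left|right]; left.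
- move=> x y z [xy|[exy xy]] [yz|[eyz yz]].
  + by left; apply: trk xy yz.
  + by left; rewrite -eyz.
  + by left; rewrite exy.
  + by right; split; [rewrite exy|apply: tr xy yz].
Qed.

(** Since parents are compared first, passing to ancestors is weakly monotone. *)
Lemma lex_ancestor (X : Type) (par : nat -> X -> X) (lt : X -> X -> Prop)
    (k d : nat) (u v : X) :
  lex par lt (k + d) u v -> ancestor par k d u = ancestor par k d v \/
    lex par lt k (ancestor par k d u) (ancestor par k d v).
Proof.
elim: d u v => [|d IHd] u v; first by rewrite addn0; right.
by rewrite addnS => -[/IHd//|[/= -> _]]; left.
Qed.

Lemma ordering_of_dim (R : realType) (M : metricType R) (p : nat) :
  compact [set: M] -> covering_dim_le M (p%:Z - 1) ->
  exists T : M -> M -> Prop, strict_total_order T /\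
    forall x y : M, x <> y ->
      exists2 e : R, 0 < e & ~ contains_snake T (ball x e) (ball y e) p.*2.
Proof.
move=> cM dM; have [V [par Vpar]] := cover_tower cM dM.
have cV k : finite_open_cover (V k) by case: (Vpar k).
have parV k U : V k.+1 U -> V k (par k U) /\ closure U `<=` par k U.
  by case: (Vpar k) => _ + _ _; apply.
have [lt lto] := strict_total_order_exists (set M).
have lexo k := lex_total_order par k lto.
have /choice[g gP] : forall q : nat * M, exists U, V q.1 U /\ U q.2.
  move=> [k x] /=; have [_ _ Vk] := cV k; have : [set: M] x by [].
  by rewrite -Vk => -[U VU Ux]; exists U.
have Vg m x : V m (g (m, x)) by case: (gP (m, x)).
have gx m x : g (m, x) x by case: (gP (m, x)).
have [F [FU ooF]] := ultraFilterLemma (F := \oo) _.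
have FF : ProperFilter F by exact: ultra_proper.
(* Comparing along an ultrafilter replaces the choice of an infinite branch
   through the sets containing a given point. *)
pose T x y := F [set m | lex par lt m (g (m, x)) (g (m, y))].
have sep x y : x <> y ->
    exists N, forall k U, (N < k)%N -> V k U -> U x -> ~ U y.
  move=> xy; have r0 : 0 < mdist x y by rewrite mdist_gt0; exact/eqP.
  have [N _ HN] := near_infty_natSinv_lt (PosNum r0).
  exists N => -[//|k] U Nk VU Ux Uy.
  have [_ _ + _] := Vpar k => /(_ U x y VU Ux Uy).
  rewrite ballEmdist /= ltNge => /negP; apply.
  by apply/ltW/HN.
exists T; split.
  apply: strict_total_orderI.
  - move=> x; rewrite /T (_ : [set _ | _] = set0).
      exact: filter_not_empty.
    by apply/seteqP; split=> // m /=; case: (lexo m) => irr _ _ /irr.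
  - move=> x y xy; have [N HN] := sep x y xy.
    have FN : F [set m | (N < m)%N] by apply: ooF; exists N.+1.
    (* The ultrafilter decides the comparison; beyond level [N] the nodes of [x] and [y] differ, so
       if one strict inequality fails the other holds. *)
    have [?|nxy] := in_ultra_setVsetC
      [set m | lex par lt m (g (m, x)) (g (m, y))] FU; first by left.
    right; apply: filterS (filterI FN nxy) => m /= [Nm nm].
    have [_ totm _] := lexo m.
    case: (totm (g (m, x)) (g (m, y))) => [e|[//]|[]//].
    by apply: (HN m (g (m, x)) Nm) => //; rewrite e.
  - move=> x y z xy yz; apply: filterS (filterI xy yz) => m /= [xym yzm].
    by have [_ _ trm] := lexo m; apply: trm xym yzm.
move=> x y xy; have [N HN] := sep x y xy; pose k := N.+1.
(* The closure of a level [k.+1] set lies in its parent, so points near [z]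
   have their level [k] ancestors among the members of [V k] containing [z]. *)
have near_closure z : exists2 e : R, 0 < e & forall U a, V k.+1 U -> U a ->
    ball z e a -> closure U z.
  have [fV _ _] := cV k.+1.
  pose C := \bigcup_(U in V k.+1 `&` [set U | ~ closure U z]) closure U.
  have : nbhs z (~` C).
    apply: open_nbhs_nbhs; split; last by move=> [U [_ /= nUz] Uz].
    apply: closed_openC; apply: closed_bigcup; first exact: finite_setIl.
    by move=> U _; exact: closed_closure.
  move=> /nbhs_ballP[e /= e0 eC]; exists e => // U a VU Ua za.
  apply: contrapT => nUz; apply: (eC a za); exists U => //.
  exact: subset_closure.
have [ex ex0 Hx] := near_closure x; have [ey ey0 Hy] := near_closure y.
exists (Num.min ex ey); first by rewrite lt_min ex0.
move=> [a [aT aU]].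
have Flt : F [set m | (k.+1 <= m)%N] by apply: ooF; exists k.+1.
(* A snake involves finitely many comparisons, so one level [m] realizes all of them. *)
have Fa : F [set m | forall i : 'I_p.*2,
    lex par lt m (g (m, a i)) (g (m, a i.+1))].
  by apply: filter_forall => i; exact: aT.
have [m [/= km lexa]] := filter_ex (filterI Flt Fa).
pose d := (m - k.+1)%N; have em : m = (k.+1 + d)%N by rewrite subnKC.
have ancP U : V (k.+1 + d)%N U ->
    V k.+1 (ancestor par k.+1 d U) /\ U `<=` ancestor par k.+1 d U.
  elim: (d) U => [|j IHj] U /=; first by rewrite addn0 => VU; split=> // z.
  rewrite addnS => /parV[/IHj[VU' UU'] UU].
  split=> //; apply: subset_trans UU'; apply: subset_trans UU.
  exact: subset_closure.
pose u i := ancestor par k.+1 d (g (m, a i)).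
(* The centre near [a i] is only known to lie in the closure of [u i]; going up one more level puts
   it in [w i] itself. *)
pose w i := par k (u i).
have uP i : V k.+1 (u i) /\ u i (a i).
  have [|Vu gu] := ancP (g (m, a i)); first by rewrite -em.
  by split=> //; apply: gu; exact: gx.
have wP i : (i <= p.*2)%N -> V k (w i) /\ w i (if odd i then y else x).
  move=> ip; have [Vu ua] := uP i; have [Vw uw] := parV _ _ Vu.
  split=> //; apply: uw; have := aU i ip; case: ifP => _ za.
    by apply: (Hy _ (a i)) => //; apply: le_ball za; rewrite ge_min lexx orbT.
  by apply: (Hx _ (a i)) => //; apply: le_ball za; rewrite ge_min lexx.
have wS i : (i < p.*2)%N -> lex par lt k (w i) (w i.+1).
  move=> ip; have wne : w i <> w i.+1.
    move=> wi; have [Vw wz] := wP i (ltnW ip); have [_] := wP i.+1 ip.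
    rewrite -wi /=; move: wz; case: (odd i) => /= wy wx.
      exact: (HN k (w i)) wx wy.
    exact: (HN k (w i)) wy wx.
  have := @lex_ancestor _ par lt k.+1 d (g (m, a i)) (g (m, a i.+1)).
  rewrite -em => /(_ (lexa (Ordinal ip)))[ui|[//|[//]]].
  by case: wne; rewrite /w /u ui.
have wlt i j : (i < j)%N -> (j <= p.*2)%N -> lex par lt k (w i) (w j).
  elim: j => // j IHj; rewrite ltnS leq_eqVlt => /orP[/eqP->|ij jp].
    exact: wS.
  by have [_ _ trk] := lexo k; apply: trk (IHj ij (ltnW jp)) (wS j jp).
(* The even indices up to [p.*2] give [p.+1] distinct members of [V k] through [x], one more than
   allowed. *)
have [_ _ _ /family_order_leP/(_ p.+1 (fun j => w j.*2) x)] := Vpar N.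
rewrite ltnn => H; suff : false by [].
apply: H.
  have winj i j : (i < j)%N -> (j <= p)%N -> w i.*2 <> w j.*2.
    move=> ij jp wij; have [irr _ _] := lexo k; apply: (irr (w i.*2)).
    by rewrite {2}wij; apply: wlt; lia.
  move=> i j; rewrite !inE /= !ltnS => ip jp wij.
  case: (ltngtP i j) => // ij; first by case: (winj i j).
  by case: (winj j i).
by move=> j jp; have := wP j.*2; rewrite odd_double; apply; lia.
Qed.

Theorem theorem1p1 (R : realType) (M : metricType R)
  (compact_M : compact [set: M]) :
  (covering_dim M < +oo)%E <->
  exists T : M -> M -> Prop,
    strict_total_order T /\ (snake_number T < +oo)%E.
Proof.
split=> [/covering_dim_lty[p dM]|[T [sT /snake_number_lty[s noS]]]].
  have [T [sT noS]] := ordering_of_dim compact_M dM.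
  by exists T; split=> //; apply/snake_number_lty; exists p.*2.
(* Excluding snakes of length [s] bounds the multiplicity by [s.+1], hence the dimension by [s]. *)
apply/covering_dim_lty; exists s.+1; apply: shrinkable_dim.
apply: (snakeless_shrinkable (T := T) (E := setT)) => //.
- exact: subset_closure.
- move=> x y _ _ /noS[e e0 nS].
  by exists e => //; rewrite !setTI.
Qed.
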